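(* Let $\Phi$ satisfy the Standing Assumption. Then for every $\lambda\in\mathbb R$ and $t\ge0$, $$\mathfrak e_\Phi(t;\lambda)=\sum_{k=0}^{+\infty}\lambda^ku_k^*(t).$$
   Context: Standing Assumption: $\Phi$ is a special Bernstein function (both $\Phi$ and $\lambda/\Phi(\lambda)$ are Bernstein functions) with Lévy–Khintchine triple $a_\Phi=b_\Phi=0$, $\nu_\Phi(0,\infty)=\infty$; the potential measure of the subordinator $\sigma_\Phi$ (with $\mathbb E e^{-\lambda\sigma_\Phi(t)}=e^{-t\Phi(\lambda)}$) has a non-increasing density $u_\Phi\ge0$, and $u_\Phi(t)\le Ct^{\beta-1}$ on $(0,t_0)$ for some $t_0,C>0,\beta\in(0,1)$. $U_\Phi(t)=\int_0^tu_\Phi(s)ds$. $L_\Phi(t)=\inf\{y>0:\sigma_\Phi(y)>t\}$ and $\mathfrak e_\Phi(t;\lambda)=\mathbb E[e^{\lambda L_\Phi(t)}]$. Define $u_0^*\equiv1$, $u_1^*=U_\Phi$, $u_{k+1}^*(t)=\int_0^tu_\Phi(t-s)u_k^*(s)ds$ for $k\ge1$. *)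

(* Defs.v *)
From HB Require Import structures.
From mathcomp Require Import all_boot all_order all_algebra.
From mathcomp Require Import all_classical all_reals all_analysis.
Set Implicit Arguments. Unset Strict Implicit. Unset Printing Implicit Defensive.
Import Order.TTheory GRing.Theory Num.Theory.
Import numFieldNormedType.Exports.
Local Open Scope classical_set_scope.
Local Open Scope ring_scope.

Definition bernstein (R : realType) (f : R -> R) : Prop :=
  (forall x, 0 < x -> 0 <= f x) /\
  (forall (n : nat) x, 0 < x -> derivable (derive1n n f) x 1) /\
  (forall (n : nat) x, 0 < x -> 0 <= (-1) ^+ n * derive1n n.+1 f x).

Definition special_bernstein (R : realType) (Phi : R -> R) : Prop :=
  bernstein Phi /\ bernstein (fun l => l / Phi l).

Definition LK_zero_triple_infinite (R : realType) (Phi : R -> R) : Prop :=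
  exists nu : {measure set R -> \bar R},
    nu [set x : R | (x <= 0)%R] = 0%E /\
    (\int[nu]_(x in [set x : R | (0 < x)%R]) (Num.min 1 x)%:E < +oo)%E /\
    nu [set x : R | (0 < x)%R] = +oo%E /\
    forall l, 0 < l ->
      (Phi l)%:E = (\int[nu]_(x in [set x : R | (0 < x)%R]) (1 - expR (- l * x))%:E)%E.

(* sigma is a subordinator with Laplace exponent Phi, on the probability space P:
   every path starts at 0, is nondecreasing and right-continuous, and the
   increments over consecutive intervals are independent and stationary with
   E exp(-l (sigma(t+h) - sigma(t))) = exp(-h Phi(l)); this is encoded by the
   joint Laplace transforms of the increments. *)
Definition subordinator (R : realType) (d : measure_display) (Omega : measurableType d)
  (P : probability Omega R) (Phi : R -> R) (sigma : R -> Omega -> R) : Prop :=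
  (forall t, 0 <= t -> measurable_fun setT (sigma t)) /\
  (forall w, sigma 0 w = 0) /\
  (forall w s t, 0 <= s -> s <= t -> sigma s w <= sigma t w) /\
  (forall w t, 0 <= t -> (sigma ^~ w) @ at_right t --> sigma t w) /\
  (forall (n : nat) (ts : nat -> R) (ls : nat -> R),
     0 <= ts 0%N ->
     (forall i, (i < n)%N -> ts i <= ts i.+1) ->
     (forall i, (i < n)%N -> 0 < ls i) ->
     (\int[P]_w (expR (- \sum_(i < n) ls i * (sigma (ts i.+1) w - sigma (ts i) w)))%:E
       = (expR (- \sum_(i < n) (ts i.+1 - ts i) * Phi (ls i)))%:E)%E).

Definition potential_density (R : realType) (d : measure_display) (Omega : measurableType d)
  (P : probability Omega R) (sigma : R -> Omega -> R) (u : R -> R) : Prop :=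
  forall A : set R, measurable A ->
    (\int[P]_w (\int[lebesgue_measure]_(s in [set x : R | (0 <= x)%R]) (\1_A (sigma s w))%:E)
     = \int[lebesgue_measure]_(x in A `&` [set x : R | (0 < x)%R]) (u x)%:E)%E.

Definition Ucum (R : realType) (u : R -> R) (t : R) : R :=
  \int[lebesgue_measure]_(s in [set x : R | (0 <= x <= t)%R]) u s.

Fixpoint ustar (R : realType) (u : R -> R) (k : nat) : R -> R :=
  match k with
  | 0%N => fun _ => 1
  | 1%N => Ucum u
  | k'.+1 => fun t => \int[lebesgue_measure]_(s in [set x : R | (0 <= x <= t)%R]) (u (t - s) * ustar u k' s)
  end.

Definition Linv (R : realType) (Omega : Type) (sigma : R -> Omega -> R) (t : R) (w : Omega) : R :=
  inf [set y | 0 < y /\ t < sigma y w].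

Definition emlf (R : realType) (d : measure_display) (Omega : measurableType d)
  (P : probability Omega R) (sigma : R -> Omega -> R) (t l : R) : \bar R :=
  (\int[P]_w (expR (l * Linv sigma t w))%:E)%E.

(* Main.v *)
Require Import Defs.
From HB Require Import structures.
From mathcomp Require Import all_boot all_order all_algebra.
From mathcomp Require Import all_classical all_reals all_analysis.
From mathcomp Require Import measurable_realfun ring lra.
Import Order.TTheory GRing.Theory Num.Theory.
Import numFieldNormedType.Exports.
Local Open Scope classical_set_scope.
Local Open Scope ring_scope.
Set Implicit Arguments. Unset Strict Implicit. Unset Printing Implicit Defensive.

(** Up to null sets {s >= 0 | sigma s <= t} is the interval from 0 to L(t), so
    exp(l L(t)) - 1 = l * \int exp(l s) 1(sigma s <= t) ds.  Taking expectations and expanding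
    exp(l s) under the integral reduces the theorem to A_k(t) = u*_{k+1}(t), where
    A_k(t) = E \int (s^k / k!) 1(sigma s <= t) ds = E[L(t)^(k+1)] / (k+1)!.  The measure with
    distribution function A_k has Laplace transform Phi^-(k+1), while u has Laplace transform
    1/Phi, so A_{k+1} is the convolution of u and A_k by injectivity of the Laplace transform.
    Injectivity comes from Doetsch's inversion formula: 1 - exp(- e^(n^2 (t - a) + n)) tends to
    1(a <= t), and for fixed n it is a power series in exp(- n^2 a).  Choosing lam with
    Phi(lam) > |l|, possible since nu is infinite, the bound
    P(sigma s <= t) <= exp(lam t - s Phi(lam)) justifies the exchange of sum and integral. *)

Local Notation leb := (@lebesgue_measure _).

Lemma measurable_natr_bool d (X : measurableType d) (R : realType) (b : X -> bool) :
  measurable_fun setT b -> measurable_fun setT (fun x => (b x)%:R : R).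
Proof.
move=> mb; rewrite (_ : (fun x => _) = (fun x => if b x then 1 else 0)); last first.
  by apply/funext => x; case: (b x).
exact: measurable_fun_ifT.
Qed.

(** * Injectivity of the Laplace transform *)

Section LaplaceInversion.
Context d (X : measurableType d) (R : realType).
Variable mu : {measure set X -> \bar R}.

Lemma cvg_integral_dominated (f_ : nat -> X -> R) (f q : X -> R) :
  (forall n, measurable_fun setT (f_ n)) -> measurable_fun setT f ->
  (forall x, (f_ ^~ x) @ \oo --> f x) ->
  (forall n x, `|f_ n x| <= q x) ->
  mu.-integrable setT (EFin \o q) ->
  (fun n => \int[mu]_x (f_ n x)%:E)%E @ \oo --> (\int[mu]_x (f x)%:E)%E.
Proof.
move=> mf_ mf f_f f_q iq.
have mf'_ n : measurable_fun setT (EFin \o f_ n) by exact/measurable_EFinP.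
have mf' : measurable_fun setT (EFin \o f) by exact/measurable_EFinP.
have f'_f : {ae mu, forall x, setT x -> (fun n => (f_ n x)%:E) @ \oo --> (f x)%:E}.
  by apply: aeW => x _; apply: cvg_EFin; [exact: nearW|exact: f_f].
have f'_q : {ae mu, forall x n, setT x -> (`|(f_ n x)%:E| <= (EFin \o q) x)%E}.
  by apply: aeW => x n _ /=; rewrite lee_fin.
by have [] := dominated_convergence measurableT mf'_ mf' f'_f iq f'_q.
Qed.

(** Laplace transform of the image under [a] of the measure with density [g] with respect to [mu].
    Keeping [a] and [g] explicit lets measures on different spaces be compared without forming image
    measures. *)
Definition laplace_integral (a g : X -> R) (lam : R) : \bar R :=
  (\int[mu]_x (g x * expR (- lam * a x))%:E)%E.

(** Taylor polynomials of [expR y - 1]. The constant term is left out because [g] itself may have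
    infinite integral. *)
Definition expm1_sum (N : nat) (y : R) : R :=
  \sum_(j < N) y ^+ j.+1 / (j.+1)`!%:R.

Lemma expm1_sum_series N (y : R) : expm1_sum N y = series (exp_coeff y) N.+1 - 1.
Proof.
rewrite /series /= big_mkord big_ord_recl /= /exp_coeff /= expr0 divr1 addrAC subrr add0r.
exact: eq_bigr.
Qed.

Lemma cvg_expm1_sum (y : R) : (expm1_sum ^~ y) @ \oo --> expR y - 1.
Proof.
under eq_fun do rewrite expm1_sum_series.
apply: cvgB; last exact: cvg_cst.
have := is_cvg_series_exp_coeff y.
by rewrite -(cvg_shiftS (series (exp_coeff y))).
Qed.

Lemma norm_series_exp_coeff N (y : R) : `|series (exp_coeff y) N| <= expR `|y|.
Proof.
apply: (@le_trans _ _ (series (exp_coeff `|y|) N)).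
  rewrite /series /=; apply: le_trans (ler_norm_sum _ _ _) _.
  by apply: ler_sum => i _; rewrite /exp_coeff /= normrM normrX normfV normr_nat.
apply: nondecreasing_cvgn_le; last exact: is_cvg_series_exp_coeff.
apply/nondecreasing_series => n _ _; by rewrite /exp_coeff /= divr_ge0// exprn_ge0.
Qed.

(** Since (j+1)! >= j!, one factor |y| splits off each term. At [y = - c * expR (- lam * a x)] this
    factor supplies the integrability, and the other one stays bounded. *)
Lemma norm_expm1_sum N (y : R) : `|expm1_sum N y| <= `|y| * expR `|y|.
Proof.
apply: (@le_trans _ _ (`|y| * series (exp_coeff `|y|) N)); last first.
  apply: ler_wpM2l => //.
  by apply: (le_trans (ler_norm _)); have := norm_series_exp_coeff N `|y|; rewrite normr_id.
rewrite /series /= big_mkord mulr_sumr; apply: le_trans (ler_norm_sum _ _ _) _.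
apply: ler_sum => i _; rewrite /exp_coeff /= normrM normrX normfV normr_nat.
rewrite exprS -mulrA; apply: ler_wpM2l => //; apply: ler_wpM2l; first exact: exprn_ge0.
by rewrite lef_pV2 ?posrE ?ltr0n ?fact_gt0// ler_nat factS leq_pmull.
Qed.

Section OneSpace.
Variables (a g : X -> R).
Hypotheses (ma : measurable_fun setT a) (mg : measurable_fun setT g).
Hypotheses (a0 : forall x, 0 <= a x) (g0 : forall x, 0 <= g x).
Variable lam0 : R.
Hypothesis lam00 : 0 <= lam0.
Hypothesis fin : forall lam, lam0 <= lam -> (laplace_integral a g lam < +oo)%E.

Lemma measurable_laplace_kernel lam :
  measurable_fun setT (fun x => g x * expR (- lam * a x)).
Proof.
apply: measurable_funM => //; apply: measurableT_comp => //.
by apply: measurable_funM => //; exact: measurable_cst.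
Qed.

Lemma integrable_laplace_kernel lam : lam0 <= lam ->
  mu.-integrable setT (fun x => (g x * expR (- lam * a x))%:E).
Proof.
move=> h; apply/integrableP; split.
  by apply/measurable_EFinP; exact: measurable_laplace_kernel.
apply: le_lt_trans (fin h); rewrite le_eqVlt; apply/orP; left; apply/eqP.
apply: eq_integral => x _ /=.
by rewrite ger0_norm// mulr_ge0// expR_ge0.
Qed.

(** Powers of [expR (- lam * a x)] are the same kernel at the rates [j.+1%:R * lam], so the integral
    depends only on the Laplace transform at multiples of [lam]. *)
Lemma integral_expm1_sum lam c N : lam0 <= lam ->
  (\int[mu]_x (g x * expm1_sum N (- c * expR (- lam * a x)))%:E
   = \sum_(j < N) ((- c) ^+ j.+1 / (j.+1)`!%:R)%:E *
      laplace_integral a g (j.+1%:R * lam))%E.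
Proof.
move=> h.
have hj j : lam0 <= j.+1%:R * lam.
  apply: (le_trans h); rewrite ler_peMl//; first exact: le_trans h.
  by rewrite ler1n.
under eq_integral => x _.
  rewrite (_ : (g x * _)%:E = \sum_(j < N) ((- c) ^+ j.+1 / (j.+1)`!%:R)%:E *
      (g x * expR (- (j.+1%:R * lam) * a x))%:E)%E; last first.
    under [RHS]eq_bigr do rewrite -EFinM.
    rewrite sumEFin; congr EFin; rewrite mulr_sumr; apply: eq_bigr => j _.
    rewrite (_ : - (_ * _) * a x = j.+1%:R * (- lam * a x)).
      by rewrite expRM_natl exprMn; ring.
    by ring.
  over.
rewrite integral_sum//; last first.
  by move=> j; apply: integrableZl => //; exact: integrable_laplace_kernel.
apply: eq_bigr => j _; rewrite integralZl//; exact: integrable_laplace_kernel.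
Qed.

Lemma cvg_integral_expm1_sum lam c : lam0 <= lam -> 0 <= c ->
  (fun N => \int[mu]_x (g x * expm1_sum N (- c * expR (- lam * a x)))%:E)%E
   @ \oo --> (\int[mu]_x (g x * (expR (- c * expR (- lam * a x)) - 1))%:E)%E.
Proof.
move=> h c0.
have my : measurable_fun setT (fun x => - c * expR (- lam * a x)).
  apply: measurable_funM => //; apply: measurableT_comp => //.
  by apply: measurable_funM.
apply: (@cvg_integral_dominated _ _ (fun x => c * expR c * (g x * expR (- lam * a x)))).
- move=> N; apply: measurable_funM => //; rewrite /expm1_sum.
  apply: measurable_sum => j; apply: measurable_funM => //.
  exact: measurable_funX.
- apply: measurable_funM => //; apply: measurable_funB => //.
  exact: measurableT_comp.
- by move=> x; apply: cvgMl_tmp; exact: cvg_expm1_sum.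
- move=> N x; rewrite normrM (ger0_norm (g0 x)).
  have z1 : expR (- lam * a x) <= 1.
    by rewrite expR_le1 mulNr oppr_le0 mulr_ge0// (le_trans lam00).
  have z0 := expR_ge0 (- lam * a x).
  have ny : `| - c * expR (- lam * a x)| = c * expR (- lam * a x).
    by rewrite normrM normrN !ger0_norm.
  apply: (@le_trans _ _ (g x * (`| - c * expR (- lam * a x)| * expR `| - c * expR (- lam * a x)|))).
    by apply: ler_wpM2l => //; exact: norm_expm1_sum.
  rewrite ny.
  have : expR (c * expR (- lam * a x)) <= expR c by rewrite ler_expR ler_piMr.
  move: (expR _) z0 => z z0 hz.
  rewrite (_ : c * expR c * _ = g x * (c * z * expR c)); last by ring.
  by apply: ler_wpM2l => //; apply: ler_wpM2l => //; exact: mulr_ge0.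
- apply: (@eq_integrable _ _ _ _ _ _ (fun x => (c * expR c)%:E * (g x * expR (- lam * a x))%:E)%E) => //.
  by apply: integrableZl => //; exact: integrable_laplace_kernel.
Qed.

(* The shift by M in the exponent makes the limit at x = t equal to 1, so that atoms at t count. *)
Definition doetsch (M t x : R) : R := 1 - expR (- expR (M ^+ 2 * t + M) * expR (- M ^+ 2 * x)).

Lemma doetschE M t x : doetsch M t x = 1 - expR (- expR (M - M ^+ 2 * (x - t))).
Proof. by rewrite /doetsch mulNr -expRD; congr (1 - expR (- expR _)); ring. Qed.

Lemma doetsch_ge0 M t x : 0 <= doetsch M t x.
Proof. by rewrite doetschE subr_ge0 expR_le1 oppr_le0 expR_ge0. Qed.

Lemma doetsch_le1 M t x : doetsch M t x <= 1.
Proof. by rewrite doetschE gerBl expR_ge0. Qed.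

Lemma doetsch_le_expR M t x : doetsch M t x <= expR (M - M ^+ 2 * (x - t)).
Proof. by rewrite doetschE; have := expR_ge1Dx (- expR (M - M ^+ 2 * (x - t))); lra. Qed.

(** A bound uniform in [M] and integrable against [g]. For [x <= t + 1] the right side is at least
    1; beyond, [M <= M ^+ 2] and [lam0 <= M ^+ 2] bring the exponent below
    [- lam0 * (x - t - 1)]. *)
Lemma doetsch_le M t x : 1 <= M -> lam0 <= M ->
  doetsch M t x <= expR (lam0 * (1 + t)) * expR (- lam0 * x).
Proof.
move=> M1 Ml; rewrite -expRD.
have [h|h] := leP (x - t) 1.
  apply: le_trans (doetsch_le1 _ _ _) _.
  rewrite -[X in X <= _]expR0 ler_expR.
  have : 0 <= lam0 * (1 - (x - t)) by rewrite mulr_ge0// subr_ge0.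
  by lra.
apply: le_trans (doetsch_le_expR _ _ _) _; rewrite ler_expR.
have MM : M <= M ^+ 2 by rewrite expr2 ler_peMl// (le_trans _ M1).
have : 0 <= (M ^+ 2 - lam0) * (x - t - 1).
  by rewrite mulr_ge0// subr_ge0; [exact: le_trans MM|exact: ltW].
by move: MM; set M2 := M ^+ 2; lra.
Qed.

(** For [x <= t] the error is [expR (- expR y)] with [y >= M], and [expR M >= M]. For
    [x >= t + 2 / M] the exponent [M - M ^+ 2 * (x - t)] is at most [- M]. The excluded window to
    the right of [t] eventually misses each fixed [x]. *)
Lemma doetsch_dist M t x : x <= t \/ 2 <= M * (x - t) -> 0 <= M ->
  `|doetsch M t x - (x <= t)%R%:R| <= expR (- M).
Proof.
move=> [xt|xt] M0.
  rewrite xt doetschE addrAC subrr add0r normrN ger0_norm ?expR_ge0// ler_expR lerN2.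
  apply: (@le_trans _ _ (expR M)); first by have := expR_ge1Dx M; lra.
  rewrite ler_expR; have : 0 <= M ^+ 2 * (t - x) by rewrite mulr_ge0 ?exprn_ge0// subr_ge0.
  by lra.
have -> : (x <= t) = false.
  apply/negbTE/negP => h; have : M * (x - t) <= 0 by rewrite mulr_ge0_le0// subr_le0.
  by lra.
rewrite subr0 ger0_norm ?doetsch_ge0//; apply: le_trans (doetsch_le_expR _ _ _) _.
rewrite ler_expR; have : 0 <= M * (M * (x - t) - 2) by rewrite mulr_ge0// subr_ge0.
by rewrite expr2; lra.
Qed.

Lemma cvg_doetsch N t x : (fun n => doetsch (n + N)%:R t x) @ \oo --> ((x <= t)%R%:R : R).
Proof.
apply/cvgrPdist_le => e e0.
have /cvgrPdist_le/(_ e e0) h := @cvgn_expR R.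
near=> n.
rewrite distrC; apply: le_trans (doetsch_dist _ _) _ => //.
- have [xt|xt] := leP x t; [by left|right].
  rewrite -ler_pdivrMr ?subr_gt0//.
  near: n; exists (Num.truncn (2 / (x - t))).+1 => // n /= hn.
  apply: ltW; apply: lt_le_trans (truncnS_gt _) _.
  by rewrite ler_nat (leq_trans hn)// leq_addr.
- apply: (@le_trans _ _ (expR (- n%:R))).
    by rewrite ler_expR lerN2 ler_nat leq_addr.
  have : `|0 - expR (- n%:R)| <= e by near: n.
  by rewrite sub0r normrN ger0_norm// expR_ge0.
Unshelve. all: by end_near. Qed.

Lemma cvg_integral_doetsch N t : 1 <= N%:R :> R -> lam0 <= N%:R ->
  (fun n => \int[mu]_x (g x * doetsch (n + N)%:R t (a x))%:E)%E @ \oo -->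
  (\int[mu]_x (g x * (a x <= t)%R%:R)%:E)%E.
Proof.
move=> N1 Nl.
have Mn n : N%:R <= (n + N)%:R :> R by rewrite ler_nat leq_addl.
apply: (@cvg_integral_dominated _ _
   (fun x => expR (lam0 * (1 + t)) * (g x * expR (- lam0 * a x)))).
- move=> n; apply: measurable_funM => //; apply: measurable_funB => //.
  apply: measurableT_comp => //; apply: measurable_funM => //.
  apply: measurableT_comp => //; exact: measurable_funM.
- apply: measurable_funM => //.
  by apply: measurable_natr_bool; exact: measurable_fun_ler.
- by move=> x; apply: cvgMl_tmp; exact: cvg_doetsch.
- move=> n x; rewrite normrM (ger0_norm (g0 x)) mulrCA; apply: ler_wpM2l => //.
  rewrite ger0_norm ?doetsch_ge0//; apply: doetsch_le; exact: le_trans (Mn n).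
- apply: (@eq_integrable _ _ _ _ _ _
    (fun x => (expR (lam0 * (1 + t)))%:E * (g x * expR (- lam0 * a x))%:E)%E) => //.
  by apply: integrableZl => //; exact: integrable_laplace_kernel.
Qed.

End OneSpace.
End LaplaceInversion.

(** For fixed [M], both integrals of the [doetsch] kernel are limits of the same series in the
    values of the common transform at multiples of [M ^+ 2]; letting [M] grow yields the indicators.
    Finiteness on the [nu] side is inherited from the equality. *)
Lemma laplace_integral_inj d1 d2 (X : measurableType d1) (Y : measurableType d2)
  (R : realType) (mu : {measure set X -> \bar R}) (nu : {measure set Y -> \bar R})
  (a g : X -> R) (b h : Y -> R) (lam0 : R) :
  measurable_fun setT a -> measurable_fun setT g ->
  measurable_fun setT b -> measurable_fun setT h ->
  (forall x, 0 <= a x) -> (forall x, 0 <= g x) ->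
  (forall y, 0 <= b y) -> (forall y, 0 <= h y) ->
  0 <= lam0 ->
  (forall lam, lam0 <= lam -> (laplace_integral mu a g lam < +oo)%E) ->
  (forall lam, lam0 <= lam -> laplace_integral mu a g lam = laplace_integral nu b h lam) ->
  forall t, (\int[mu]_x (g x * (a x <= t)%R%:R)%:E
    = \int[nu]_y (h y * (b y <= t)%R%:R)%:E)%E.
Proof.
move=> ma mg mb mh a0 g0 b0 h0 lam00 fg eqgh t.
have fh lam : lam0 <= lam -> (laplace_integral nu b h lam < +oo)%E.
  by move=> l; rewrite -eqgh// fg.
(* Starting the sequence at [N] makes every [M = n + N] satisfy [1 <= M] and [lam0 <= M], hence
   [lam0 <= M ^+ 2]. *)
pose N := (Num.truncn lam0).+1.
have Nl : lam0 <= N%:R by exact/ltW/truncnS_gt.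
have N1 : 1 <= N%:R :> R by rewrite ler1n.
have eN n : (\int[mu]_x (g x * doetsch (n + N)%:R t (a x))%:E
    = \int[nu]_y (h y * doetsch (n + N)%:R t (b y))%:E)%E.
  set M := (n + N)%:R.
  have MN : N%:R <= M by rewrite ler_nat leq_addl.
  have M1 : 1 <= M by exact: le_trans MN.
  have M2 : lam0 <= M ^+ 2.
    by rewrite (le_trans Nl)// (le_trans MN)// expr2 ler_peMl// (le_trans _ M1).
  have c0 := expR_ge0 (M ^+ 2 * t + M).
  have [ca cb] := (cvg_integral_expm1_sum ma mg a0 g0 lam00 fg M2 c0,
                   cvg_integral_expm1_sum mb mh b0 h0 lam00 fh M2 c0).
  rewrite /doetsch.
  have {}ec : (\int[mu]_x (g x * (expR (- expR (M ^+ 2 * t + M) * expR (- M ^+ 2 * a x)) - 1))%:E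
    = \int[nu]_x (h x * (expR (- expR (M ^+ 2 * t + M) * expR (- M ^+ 2 * b x)) - 1))%:E)%E.
    apply: (cvg_unique _ ca) => //.
    apply: cvg_trans cb; apply: near_eq_cvg; apply: nearW => K.
    rewrite (integral_expm1_sum mb mh h0 lam00 fh)// (integral_expm1_sum ma mg g0 lam00 fg)//.
    apply: eq_bigr => j _; rewrite eqgh//.
    by rewrite (le_trans M2)// ler_peMl ?sqr_ge0// ler1n.
  (* [doetsch] is the negative of the factor integrated in [ec]; the integrands have constant sign,
     so negation passes through the integrals. *)
  move: ec; under eq_integral do rewrite -opprB mulrN EFinN.
  under [in RHS]eq_integral do rewrite -opprB mulrN EFinN.
  rewrite !integral_ge0N; first exact: oppe_inj.
  - by move=> y _; rewrite lee_fin mulr_ge0//; exact: doetsch_ge0.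
  - by move=> x _; rewrite lee_fin mulr_ge0//; exact: doetsch_ge0.
have ca := cvg_integral_doetsch (t := t) ma mg g0 lam00 fg N1 Nl.
have cb := cvg_integral_doetsch (t := t) mb mh h0 lam00 fh N1 Nl.
move: ca; under eq_fun do rewrite eN.
by move=> ca; apply: (cvg_unique _ ca cb).
Qed.

(** * Integrals on the real line *)

(** Density of the (k+1)-fold convolution power of Lebesgue measure on the half-line; the built-in
    cutoff lets integrals run over the whole line. *)
Definition gamma_weight (R : realType) (k : nat) (s : R) : R :=
  (0 <= s)%R%:R * (s ^+ k / k`!%:R).

Section RealIntegrals.
Variable R : realType.
Implicit Types (c s t r l L : R) (k : nat).

Lemma gamma_weight_ge0 k s : 0 <= gamma_weight k s.
Proof.
rewrite /gamma_weight; have [s0|s0] := leP 0 s; last by rewrite mul0r.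
by rewrite mul1r divr_ge0// exprn_ge0.
Qed.

Lemma measurable_gamma_weight k : measurable_fun setT (@gamma_weight R k).
Proof.
apply: measurable_funM.
  by apply: measurable_natr_bool; exact: measurable_fun_ler.
by apply: measurable_funM => //; exact: measurable_funX.
Qed.

Let derivable_continuous (F : R -> R) (f : R -> R) :
  (forall x : R, is_derive x 1 F (f x)) -> continuous F.
Proof.
move=> dF x; apply/differentiable_continuous/derivable1_diffP.
by have [] := dF x.
Qed.

Lemma integral_is_derive (F f : R -> R) (a b : R) : a <= b ->
  (forall x : R, is_derive x 1 F (f x)) -> continuous f ->
  (\int[leb]_(x in `[a, b]) (f x)%:E = (F b - F a)%:E)%E.
Proof.
rewrite le_eqVlt => /predU1P[<- _ _|ab dF cf].
  by rewrite set_itv1 integral_set1 subrr.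
have cF := derivable_continuous dF.
rewrite (@continuous_FTC2 _ f F)//.
- exact: continuous_subspaceT.
- split => [x _||]; first by have [] := dF x.
  + by apply: cvg_at_right_filter; exact: cF.
  + by apply: cvg_at_left_filter; exact: cF.
- by move=> x _; rewrite derive1E; have [] := dF x.
Qed.

Lemma is_derive_expRMl c (s : R) : is_derive s 1 (fun x => expR (c * x)) (c * expR (c * s)).
Proof.
have h1 : is_derive s 1 (fun x => c * x) c.
  by apply: is_derive_eq; rewrite /GRing.scale /= mulr1.
rewrite mulrC.
exact: (@is_derive1_comp R expR (fun x => c * x) s _ _ (is_derive_expR _) h1).
Qed.

Lemma continuous_expRMl c : continuous (fun x : R => expR (c * x)).
Proof. by apply: derivable_continuous => x; exact: is_derive_expRMl. Qed.

Lemma integral_expR_tail c r : 0 < c ->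
  (\int[leb]_(s in `[r, +oo[) (expR (- c * s))%:E = (expR (- c * r) / c)%:E)%E.
Proof.
move=> c0.
have dF (x : R) : is_derive x 1 (fun x => - c^-1 * expR (- c * x)) (expR (- c * x)).
  have := is_derive_expRMl (- c) x => h.
  apply: is_derive_eq; rewrite /= scalerA mulrNN mulVf ?gt_eqF// scale1r//.
have cF := derivable_continuous dF.
rewrite (@ge0_continuous_FTC2y _ _ (fun x => - c^-1 * expR (- c * x)) _ 0)//.
- by rewrite sub0e -EFinN; congr EFin; ring.
- by apply: continuous_subspaceT; exact: continuous_expRMl.
- rewrite -[X in _ --> X](mulr0 (- c^-1)); apply: cvgMl_tmp.
  rewrite (_ : (fun x => expR (- c * x)) =
               (fun z => expR (- z)) \o (fun z => c * z)); last first.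
    by apply: eq_fun => x; rewrite mulNr.
  apply: (@cvg_comp _ _ _ _ _ _ (pinfty_nbhs R)); last exact: cvgr_expR.
  exact: gt0_cvgMry.
- by apply: cvg_at_right_filter; exact: cF.
- by move=> x _; rewrite derive1E; have [] := dF x.
Qed.

Lemma integral_exprn k (s : R) : 0 <= s ->
  (\int[leb]_(r in `[0%R, s]) (r ^+ k / k`!%:R)%:E = (s ^+ k.+1 / k.+1`!%:R)%:E)%E.
Proof.
move=> s0.
have dF (x : R) : is_derive x 1 (fun x : R => x ^+ k.+1 / k.+1`!%:R) (x ^+ k / k`!%:R).
  have hX : is_derive x 1 (fun y : R => y ^+ k.+1) (k.+1%:R * x ^+ k).
    apply: DeriveDef; first exact: exprn_derivable.
    by rewrite exp_derive /GRing.scale /= mulr1.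
  have hZ := is_deriveZ k.+1`!%:R^-1 hX.
  rewrite (_ : (fun _ => _) = k.+1`!%:R^-1 \*: (fun y : R => y ^+ k.+1)); last first.
    by apply/funext => y; rewrite mulrC.
  apply: is_derive_eq; rewrite factS natrM invfM.
  have := fact_gt0 k; rewrite -(ltr_nat R) => f0.
  by rewrite /GRing.scale /=; field; rewrite !gt_eqF.
have cf : continuous (fun x : R => x ^+ k / k`!%:R).
  by move=> x; apply: cvgMr_tmp; exact: exprn_continuous.
by rewrite (integral_is_derive s0 dF cf) expr0n mul0r subr0.
Qed.

Lemma integral_expRMl l L : 0 <= L ->
  (\int[leb]_(s in `[0%R, L]) (l * expR (l * s))%:E = (expR (l * L) - 1)%:E)%E.
Proof.
move=> L0.
have cf : continuous (fun x => l * expR (l * x)).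
  by move=> x; apply: cvgMl_tmp; exact: continuous_expRMl.
by rewrite (integral_is_derive L0 (is_derive_expRMl l) cf) mulr0 expR0.
Qed.

End RealIntegrals.

(** * Gamma integrals and reflection of Lebesgue measure *)

Section GammaReflection.
Variable R : realType.
Implicit Types (c s t r l L : R) (k : nat).

Lemma integral_indicator_mul d (X : measurableType d) (mu : {measure set X -> \bar R})
  (b : X -> bool) (f : X -> R) :
  (\int[mu]_x ((b x)%:R * f x)%:E = \int[mu]_(x in [set x | b x]) (f x)%:E)%E.
Proof.
rewrite [RHS]integral_mkcond; apply: eq_integral => x _; rewrite patchE.
case: ifPn => h; first by rewrite (set_mem h) mul1r.
by rewrite (_ : b x = false) ?mul0r//; apply/negbTE/negP => bx; move/negP: h; apply; exact/mem_set.
Qed.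

(** Induction on [k]: [gamma_weight k.+1 s] is the integral of [gamma_weight k] over [[0, s]].
    Exchanging the integrals leaves an exponential tail, which contributes the factor [c^-1]. *)
Lemma integral_gamma_weight k c : 0 < c ->
  (\int[leb]_(s in setT) (gamma_weight k s * expR (- c * s))%:E = (c ^- k.+1)%:E)%E.
Proof.
move=> c0; elim: k => [|k ih].
  under eq_integral do rewrite /gamma_weight expr0 divr1 mulr1.
  rewrite integral_indicator_mul (_ : [set _ | _] = `[0, +oo[%classic).
    by rewrite integral_expR_tail// mulr0 expR0 div1r expr1.
  by apply/seteqP; split => x /=; rewrite in_itv /= andbT.
pose F (z : measurableTypeR R * measurableTypeR R) :=
  gamma_weight k z.2 * ((z.2 <= z.1)%R%:R * expR (- c * z.1)).
have mF : measurable_fun setT F.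
  apply: measurable_funM.
    apply: (@measurableT_comp _ _ _ _ _ _ (@gamma_weight R k) _
      (snd : measurableTypeR R * measurableTypeR R -> R)).
      exact: measurable_gamma_weight.
    exact: measurable_snd.
  apply: measurable_funM.
    by apply: measurable_natr_bool; exact: measurable_fun_ler.
  by apply: measurableT_comp => //; exact: measurable_funM.
have F0 z : 0 <= F z.
  by rewrite /F mulr_ge0 ?gamma_weight_ge0// mulr_ge0 ?expR_ge0.
have mF' : measurable_fun setT (EFin \o F) by exact/measurable_EFinP.
have F0' z : (0 <= (EFin \o F) z)%E by rewrite lee_fin.
have := @fubini_tonelli _ _ _ _ _ leb leb (EFin \o F) mF' F0'.
under eq_integral => s _.
  rewrite (_ : (\int[_]_y _)%E = (gamma_weight k.+1 s * expR (- c * s))%:E); last first.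
    rewrite /F /=.
    have [s0|s0] := leP 0 s; last first.
      rewrite integral0_eq => [|r _]; last first.
        rewrite /gamma_weight; have [r0|r0] := leP 0 r; last by rewrite !mul0r.
        by rewrite leNgt (lt_le_trans s0 r0) mul0r mulr0.
      by rewrite /gamma_weight leNgt s0 !mul0r.
    under eq_integral => r _.
      rewrite (_ : _ * _ = (0 <= r <= s)%R%:R * (expR (- c * s) * (r ^+ k / k`!%:R))).
        over.
      by rewrite /gamma_weight; do 2 case: leP => _ /=; ring.
    rewrite integral_indicator_mul.
    rewrite (_ : [set _ | _] = `[0, s]%classic); last first.
      by apply/seteqP; split => x /=; rewrite in_itv.
    under eq_integral do rewrite EFinM.
    rewrite ge0_integralZl//.
    - by rewrite integral_exprn// -EFinM /gamma_weight s0 mul1r mulrC.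
    - by apply/measurable_EFinP; apply: measurable_funM.
    - move=> x /=; rewrite in_itv /= => /andP[x0 _].
      by rewrite lee_fin divr_ge0// exprn_ge0.
  over.
move=> ->.
under eq_integral => r _.
  rewrite (_ : (\int[_]_y _)%E = (c^-1)%:E * (gamma_weight k r * expR (- c * r))%:E)%E; last first.
    rewrite /F /=; under eq_integral do rewrite EFinM.
    rewrite ge0_integralZl//.
    - rewrite integral_indicator_mul.
      rewrite (_ : [set _ | _] = `[r, +oo[%classic); last first.
        by apply/seteqP; split => x /=; rewrite in_itv /= andbT.
      by rewrite integral_expR_tail// -!EFinM; congr EFin; ring.
    - apply/measurable_EFinP; apply: measurable_funM => //.
        by apply: measurable_natr_bool; exact: measurable_fun_ler.
      by apply: measurableT_comp => //; exact: measurable_funM.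
    - by rewrite lee_fin gamma_weight_ge0.
  over.
rewrite ge0_integralZl//.
- by rewrite ih -EFinM [in RHS]exprS invfM.
- apply/measurable_EFinP; apply: measurable_funM => //; first exact: measurable_gamma_weight.
  by apply: measurableT_comp => //; exact: measurable_funM.
- by move=> x _; rewrite lee_fin mulr_ge0 ?gamma_weight_ge0// expR_ge0.
- by rewrite lee_fin invr_ge0 ltW.
Qed.

(** Lebesgue measure is determined by its values on half-open intervals, and the preimage of []a,
    b]] is [[t - b, t - a[], of the same length. *)
Lemma lebesgue_measure_reflection t (A : set (measurableTypeR R)) : measurable A ->
  leb A = pushforward leb (fun x : measurableTypeR R => t - x : measurableTypeR R) A.
Proof.
have mf : measurable_fun setT (fun x : measurableTypeR R => t - x : measurableTypeR R).
  exact: measurable_funB.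
pose f_mixin := isMeasurableFun.Build _ _ _ _ _ mf.
pose f : {mfun measurableTypeR R >-> measurableTypeR R} :=
  HB.pack (fun x : measurableTypeR R => t - x : measurableTypeR R) f_mixin.
apply: (lebesgue_measure_unique (mu := pushforward leb f)) => X [[a b] /= ab <-].
rewrite /pushforward (_ : _ @^-1` _ = `[t - b, t - a[%classic); last first.
  by apply/seteqP; split => x /=; rewrite !in_itv /= => /andP[]; lra.
rewrite !lebesgue_measure_itv /= !lte_fin.
rewrite ltrD2l ltrN2; case: ifP => // _.
by rewrite -!EFinB; congr EFin; ring.
Qed.

Lemma integral_reflection t (f : R -> \bar R) :
  measurable_fun setT (f : measurableTypeR R -> \bar R) -> (forall x, 0 <= f x)%E ->
  (\int[leb]_x f (t - x)%R = \int[leb]_x f x)%E.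
Proof.
move=> mf f0.
have mr : measurable_fun setT (fun x : measurableTypeR R => t - x : measurableTypeR R).
  exact: measurable_funB.
have := ge0_integral_pushforward mr leb (D := setT) measurableT mf (fun y _ => f0 y).
rewrite preimage_setT => <-.
by apply: eq_measure_integral => A mA _; exact: (esym (lebesgue_measure_reflection t mA)).
Qed.

End GammaReflection.

(** * Subordinators and their potential *)

(** By monotone convergence [Phi n] tends to the total mass of [nu] on the positive half-line, which
    is infinite; monotonicity of [Phi] extends the bound from one integer to all larger
    arguments. *)
Lemma LK_unbounded (R : realType) (Phi : R -> R) : LK_zero_triple_infinite Phi ->
  forall K : R, exists2 lam0 : R, 0 < lam0 & forall lam, lam0 <= lam -> K < Phi lam.
Proof.
move=> [nu [_ [_ [nuoo PhiE]]]] K.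
pose D := [set x : measurableTypeR R | 0 < x].
have mD : measurable D.
  by rewrite (_ : D = `]0, +oo[%classic)//; apply/seteqP; split => x /=; rewrite in_itv /= andbT.
pose f (lam x : R) := 1 - expR (- lam * x).
have mf lam : measurable_fun D (EFin \o f lam).
  apply/measurable_EFinP; apply: measurable_funB => //; apply: measurableT_comp => //.
have f0 lam x : 0 <= lam -> D x -> 0 <= f lam x.
  by move=> l0 x0; rewrite subr_ge0 expR_le1 mulNr oppr_le0 mulr_ge0// ltW.
have fmono x l l' : D x -> l <= l' -> f l x <= f l' x.
  by move=> x0 ll; rewrite lerB// ler_expR !mulNr lerN2 ler_wpM2r// ltW.
have Phi_mono l l' : 0 < l -> l <= l' -> Phi l <= Phi l'.
  move=> l0 ll; rewrite -lee_fin !PhiE//; last exact: lt_le_trans ll.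
  apply: ge0_le_integral => //.
  - by move=> x Dx; rewrite lee_fin; apply: f0 => //; exact: ltW.
  - exact: (mf l).
  - exact: (mf l').
  - by move=> x Dx; rewrite lee_fin; exact: fmono.
(* The index is shifted because the integral formula for [Phi] is available at positive arguments
   only. *)
have h : (fun n => (Phi n.+1%:R)%:E) @ \oo --> +oo%E.
  rewrite -nuoo -/D.
  under eq_fun do rewrite PhiE//.
  rewrite (_ : nu D = (\int[nu]_(x in D) (limn (fun n => (f n.+1%:R x)%:E)))%E); last first.
    transitivity (\int[nu]_(x in D) 1)%E; first by rewrite integral_cst// mul1e.
    apply: eq_integral => x /set_mem x0.
    apply/esym/cvg_lim => //; apply: cvg_EFin; first exact: nearW.
    rewrite -[X in _ --> X]subr0; apply: cvgB; first exact: cvg_cst.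
    rewrite (_ : (fun n => _) = (fun z => expR (- z)) \o (fun n : nat => n.+1%:R * x)); last first.
      by apply: eq_fun => n /=; rewrite mulNr.
    apply: (@cvg_comp _ _ _ _ _ _ (pinfty_nbhs R)); last exact: cvgr_expR.
    apply/cvgryPge => M; near=> n; rewrite -ler_pdivrMr//.
    by apply: (@le_trans _ _ n%:R); [near: n; exact: nbhs_infty_ger|rewrite ler_nat].
  apply: cvg_monotone_convergence => //.
  - by move=> n; exact: mf.
  - by move=> n x x0; rewrite lee_fin f0.
  - by move=> x x0 m n mn; rewrite lee_fin; apply: fmono => //; rewrite ler_nat.
have /cvgeryP/cvgryPgt/(_ K) := h.
move=> [n _ /(_ n (leqnn n)) /= hn].
by exists n.+1%:R => // lam hl; apply: lt_le_trans hn _; exact: Phi_mono.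
Unshelve. all: by end_near. Qed.

Section Subordinator.
Context (R : realType) (d : measure_display) (Omega : measurableType d).
Context (P : probability Omega R) (Phi : R -> R) (sigma : R -> Omega -> R).

(* Nothing is known about sigma at negative times, hence the truncation. *)
Definition subordinator_path (z : measurableTypeR R * Omega) : R := sigma (Num.max 0 z.1) z.2.
Local Notation tau := subordinator_path.
Local Notation X := (leb \x P)%E.

Lemma sigma_finite_lebesgue_product : sigma_finite setT X.
Proof.
have [F TF Foo] := sigma_finiteT (@lebesgue_measure R).
exists (fun n => F n `*` setT).
  rewrite -setXTT TF predeqE => -[x y]; split => [[/= [n _ Fnx] _]|[n _ [/= Fnx _]]].
    by exists n.
  by split => //; exists n.
move=> k; have [mF Fk] := Foo k; split; first exact: measurableX.
by rewrite product_measure1E// [X in (_ * X)%E]probability_setT mule1.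
Qed.

(* The library's sigma-finiteness instance for products is only inferred for subprobabilities. *)
Definition path_measure : {sigma_finite_measure set (measurableTypeR R * Omega)%type -> \bar R} :=
  HB.pack X (Measure_isSigmaFinite.Build _ _ _ X sigma_finite_lebesgue_product).

Hypothesis subP : subordinator P Phi sigma.

Lemma measurable_subordinator_path : measurable_fun setT tau.
Proof.
have [ms [_ [mono [rc _]]]] := subP.
have max0 (x : R) : 0 <= Num.max 0 x by rewrite le_max lexx.
apply: (measurability (@RGenInftyO.G R)); first exact: RGenInftyO.measurableE.
move=> /= _ [_] [a ->] <-; rewrite setTI.
(* Joint measurability from countably many sections: [tau (s, w) < a] exactly when some rational [q]
   above the truncated time has [sigma q w < a]. Right-continuity provides [q], monotonicity gives
   the converse. *)
rewrite (_ : _ @^-1` _ = \bigcup_(q : rat)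
   ([set s : measurableTypeR R | Num.max 0 s < ratr q]
    `*` [set w | sigma (Num.max 0 (ratr q)) w < a])).
  apply: bigcupT_measurable_rat => q.
  apply: measurableX => /=.
    rewrite (_ : [set s | _] = (fun s : measurableTypeR R => Num.max 0 s) @^-1` `]-oo, ratr q[%classic).
      by rewrite -[X in measurable X]setTI; apply: measurable_maxr => //; exact: measurable_cst.
    by apply/seteqP; split => x /=; rewrite in_itv.
  rewrite (_ : [set w | _] = (sigma (Num.max 0 (ratr q))) @^-1` `]-oo, a[%classic).
    by rewrite -[X in measurable X]setTI; exact: ms.
  by apply/seteqP; split => x /=; rewrite in_itv.
apply/seteqP; split => [[s w]|[s w]] /=; rewrite in_itv /= /tau /=.
  have := max0 s; set t := Num.max 0 s => t0 sa.
  have /cvgr_lt/(_ a sa) := rc w t t0.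
  move=> ha; have [y [ty ya]] := filter_ex (filterI (nbhs_right_gt t) ha).
  have [q] := rat_in_itvoo ty; rewrite in_itv /= => /andP[tq qy].
  exists q => //=; split => //.
  have q0 : 0 <= ratr q :> R by apply: (le_trans t0); exact: ltW.
  apply: le_lt_trans ya; rewrite max_r//; apply: mono => //; exact: ltW.
move=> [q _ /= [sq qa]].
by apply: le_lt_trans qa; apply: mono => //; rewrite le_max (ltW sq) orbT.
Qed.

Lemma subordinator_path_ge0 z : 0 <= tau z.
Proof.
have [_ [s0 [mono _]]] := subP.
by rewrite -(s0 z.2); apply: mono => //; rewrite le_max lexx.
Qed.

Lemma expectation_laplace_subordinator lam s : 0 < lam -> 0 <= s ->
  (\int[P]_w (expR (- lam * sigma s w))%:E = (expR (- Phi lam * s))%:E)%E.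
Proof.
move=> l0 s0; have [_ [s00 [_ [_ lap]]]] := subP.
(* The increment hypothesis with the single increment from time 0 to [s]. *)
have := lap 1%N (fun i => if i is 0%N then 0 else s) (fun _ => lam) (lexx 0).
move=> h; have {}h := h (fun i => _) (fun i _ => l0).
have {}h := h (ltac:(by case)).
move: h; under eq_integral do rewrite big_ord1 /= s00 subr0 -mulNr.
by rewrite big_ord1 /= subr0 -mulrN mulrC.
Qed.

(** Integrating over [Omega] first replaces [expR (- lam * tau z)] by its mean
    [expR (- Phi lam * s)]: a Laplace transform in space at [lam] becomes one in time at
    [Phi lam]. *)
Lemma integral_weight_laplace (phi : R -> R) lam :
  measurable_fun setT (phi : measurableTypeR R -> R) ->
  (forall s, 0 <= phi s) -> (forall s, s < 0 -> phi s = 0) -> 0 < lam ->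
  (\int[X]_z (phi z.1 * expR (- lam * tau z))%:E =
   \int[leb]_s (phi s * expR (- Phi lam * s))%:E)%E.
Proof.
move=> mphi phi0 phineg l0.
have mF : measurable_fun setT
    (EFin \o (fun z : measurableTypeR R * Omega => phi z.1 * expR (- lam * tau z))).
  apply/measurable_EFinP; apply: measurable_funM.
    exact: (measurableT_comp mphi measurable_fst).
  apply: measurableT_comp => //; apply: measurable_funM => //.
  exact: measurable_subordinator_path.
rewrite (fubini_tonelli1 _ mF) => [|z]; last first.
  by rewrite lee_fin mulr_ge0// expR_ge0.
apply: eq_integral => s _; rewrite /fubini_F /=.
have [s0|s0] := leP 0 s; last first.
  by rewrite phineg// mul0r integral0_eq// => w _; rewrite mul0r.
under eq_integral do rewrite EFinM.
rewrite ge0_integralZl//.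
- by rewrite /tau /= max_r// expectation_laplace_subordinator// -EFinM.
- apply/measurable_EFinP; apply: measurableT_comp => //; apply: measurable_funM => //.
  by have [ms _] := subP; rewrite /subordinator_path /= max_r//; exact: ms.
- by rewrite lee_fin.
Qed.

End Subordinator.

(** Monotonicity and the potential identity constrain [u] at positive arguments only; elsewhere its
    value is replaced by 0. *)
Definition pos_density (R : realType) (u : R -> R) (x : R) : R := (0 < x)%R%:R * u x.

Section Potential.
Context (R : realType) (d : measure_display) (Omega : measurableType d).
Context (P : probability Omega R) (Phi : R -> R) (sigma : R -> Omega -> R).
Local Notation tau := (subordinator_path sigma).
Local Notation X := (leb \x P)%E.
Hypothesis subP : subordinator P Phi sigma.
Variable u : R -> R.
Hypothesis potP : potential_density P sigma u.
Hypothesis u0 : forall x, 0 <= u x.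
Hypothesis u_noninc : forall x y, 0 < x -> x <= y -> u y <= u x.
Local Notation v := (pos_density u).
Let mtau := measurable_subordinator_path subP.

Lemma pos_density_ge0 x : 0 <= v x.
Proof. by rewrite mulr_ge0. Qed.

(** Monotonicity makes every upper level set of [u] in the positive half-line an interval. *)
Lemma measurable_pos_density : measurable_fun setT (v : measurableTypeR R -> R).
Proof.
have mu : measurable_fun (`]0, +oo[%classic : set (measurableTypeR R)) u.
  move=> mD; apply: (measurability (@RGenCInfty.G R)) => //; first exact: RGenCInfty.measurableE.
  move=> /= _ [_] [r ->] <-; apply: is_interval_measurable => s t /=.
  rewrite !in_itv/= !andbT => -[s0 us] [t0 ut] x /andP[sx xt].
  have x0 : 0 < x by exact: lt_le_trans sx.
  by rewrite !in_itv /= !andbT; split => //; apply: le_trans ut _; exact: u_noninc.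
rewrite (_ : v = u \_ `]0, +oo[).
  by apply/measurable_restrict => //; rewrite setTI.
apply/funext => x; rewrite patchE mem_setE in_itv /= andbT /pos_density.
by case: ifP => _; rewrite ?mul1r ?mul0r.
Qed.

Lemma integral_path_indic (A : set R) : measurable (A : set (measurableTypeR R)) ->
  (\int[X]_z ((0 <= z.1)%R%:R * \1_A (tau z))%:E = \int[leb]_x (v x * \1_A x)%:E)%E.
Proof.
move=> mA.
have mF : measurable_fun setT
    (EFin \o (fun z : measurableTypeR R * Omega => (0 <= z.1)%R%:R * (\1_A (tau z) : R))).
  apply/measurable_EFinP; apply: measurable_funM.
    by apply: measurable_natr_bool; exact: measurable_fun_ler.
  by apply: measurableT_comp => //; exact: measurable_indic.
rewrite (fubini_tonelli2 _ mF) => [|z]; last by rewrite lee_fin mulr_ge0.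
transitivity (\int[P]_w (\int[leb]_(s in [set x : R | (0 <= x)%R]) (\1_A (sigma s w))%:E))%E.
  apply: eq_integral => w _; rewrite /fubini_G /= integral_indicator_mul.
  by apply: eq_integral => s /set_mem /= s0; rewrite /subordinator_path /= max_r.
rewrite potP// [LHS]integral_mkcond; apply: eq_integral => x _.
rewrite patchE /pos_density indicE in_setI.
rewrite (_ : (x \in [set x | 0 < x]) = (0 < x)); last first.
  by apply/idP/idP; rewrite inE.
by case: (x \in A); case: (0 < x) => /=; rewrite ?(mul1r, mul0r, mulr0, mulr1).
Qed.

Lemma integral_layer (y : R) : 0 <= y -> (\int[leb]_r ((0 <= r < y)%R%:R)%:E = y%:E)%E.
Proof.
move=> y0; under eq_integral do rewrite -[_%:R]mulr1.
rewrite integral_indicator_mul (_ : [set _ | _] = `[0, y[%classic); last first.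
  by apply/seteqP; split => x /=; rewrite in_itv.
rewrite integral_cst// mul1e [LHS]lebesgue_measure_itv /= lte_fin.
by case: ltP => [|y0']; rewrite ?sube0//; congr EFin; apply/eqP; rewrite eq_le y0.
Qed.

(* The layer-cake formula reduces the identity to indicator functions. *)
Lemma integral_path_potential (f : R -> R) :
  measurable_fun setT (f : measurableTypeR R -> R) -> (forall x, 0 <= f x) ->
  (\int[X]_z ((0 <= z.1)%R%:R * f (tau z))%:E = \int[leb]_x (v x * f x)%:E)%E.
Proof.
move=> mf f0.
have layer (c y : R) : 0 <= c -> 0 <= y ->
    (\int[leb]_r (c * (0 <= r < y)%R%:R)%:E = (c * y)%:E)%E.
  move=> c0 y0; under eq_integral do rewrite EFinM.
  rewrite ge0_integralZl//; first by rewrite integral_layer.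
  - apply/measurable_EFinP; apply: measurable_natr_bool.
    by apply: measurable_and; [exact: measurable_fun_ler|exact: measurable_fun_ltr].
transitivity (\int[X]_z \int[leb]_r ((0 <= z.1)%R%:R * (0 <= r < f (tau z))%R%:R)%:E)%E.
  by apply: eq_integral => z _; rewrite layer.
transitivity (\int[leb]_x \int[leb]_r (v x * (0 <= r < f x)%R%:R)%:E)%E; last first.
  by apply: eq_integral => x _; rewrite layer// pos_density_ge0.
pose F (y : (measurableTypeR R * Omega) * measurableTypeR R) :=
  ((0 <= y.1.1)%R%:R * (0 <= y.2 < f (tau y.1))%R%:R : R).
have mF : measurable_fun setT (EFin \o F).
  apply/measurable_EFinP; apply: measurable_funM.
    apply: measurable_natr_bool; apply: measurable_fun_ler => //.
    exact: (measurableT_comp measurable_fst measurable_fst).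
  apply: measurable_natr_bool; apply: measurable_and.
    by apply: measurable_fun_ler.
  apply: measurable_fun_ltr => //.
  apply: measurableT_comp => //; apply: measurableT_comp => //.
pose G (y : measurableTypeR R * measurableTypeR R) := v y.1 * (0 <= y.2 < f y.1)%R%:R.
have mG : measurable_fun setT (EFin \o G).
  apply/measurable_EFinP; apply: measurable_funM.
    exact: (measurableT_comp measurable_pos_density measurable_fst).
  apply: measurable_natr_bool; apply: measurable_and.
    by apply: measurable_fun_ler.
  apply: measurable_fun_ltr => //.
  exact: (measurableT_comp mf measurable_fst).
have F0 y : (0 <= (EFin \o F) y)%E by rewrite lee_fin mulr_ge0.
have G0 y : (0 <= (EFin \o G) y)%E by rewrite lee_fin mulr_ge0// pos_density_ge0.
transitivity (\int[leb]_r \int[X]_z (EFin \o F) (z, r))%E.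
  exact: (@fubini_tonelli _ _ _ _ _ (path_measure P) leb _ mF F0).
transitivity (\int[leb]_r \int[leb]_x (EFin \o G) (x, r))%E; last first.
  exact/esym/(@fubini_tonelli _ _ _ _ _ leb leb _ mG G0).
apply: eq_integral => r _.
pose A : set (measurableTypeR R) := [set x | 0 <= r < f x].
have mA : measurable A.
  have : measurable_fun setT (fun x : measurableTypeR R => 0 <= r < f x).
    by apply: measurable_and; [exact: measurable_fun_ler|exact: measurable_fun_ltr].
  by move=> /(_ measurableT [set true] I); rewrite setTI.
have AE x : (0 <= r < f x)%R%:R = \1_A x :> R.
  by rewrite indicE; congr (_%:R); congr nat_of_bool; apply/idP/idP; rewrite inE.
transitivity (\int[X]_z ((0 <= z.1)%R%:R * \1_A (tau z))%:E)%E.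
  by apply: eq_integral => z _; rewrite /F /= AE.
by rewrite integral_path_indic//; apply: eq_integral => x _; rewrite /G /= AE.
Qed.

(** The potential identity turns the left side into an integral of [expR (- lam * tau z)] over time
    and [Omega]; the mean at time [s] is [expR (- Phi lam * s)], which integrates to
    [(Phi lam)^-1]. *)
Lemma laplace_pos_density lam : 0 < lam -> 0 < Phi lam ->
  (\int[leb]_x (v x * expR (- lam * x))%:E = ((Phi lam)^-1)%:E)%E.
Proof.
move=> l0 Pl.
rewrite -(@integral_path_potential (fun x => expR (- lam * x))).
- under eq_integral => z _.
    rewrite (_ : (0 <= z.1)%R%:R = gamma_weight 0 z.1).
      over.
    by rewrite /gamma_weight expr0 divr1 mulr1.
  rewrite (integral_weight_laplace subP (phi := gamma_weight 0))//.
  + by rewrite integral_gamma_weight// expr1.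
  + exact: measurable_gamma_weight.
  + exact: gamma_weight_ge0.
  + by move=> s s0; rewrite /gamma_weight leNgt s0 mul0r.
- by apply: measurableT_comp => //; exact: measurable_funM.
- by move=> x; exact: expR_ge0.
Qed.

End Potential.

(** * Moments of the inverse subordinator *)

Section InverseMoments.
Context (R : realType) (d : measure_display) (Omega : measurableType d).
Context (P : probability Omega R) (Phi : R -> R) (sigma : R -> Omega -> R).
Local Notation tau := (subordinator_path sigma).
Local Notation X := (leb \x P)%E.
Hypothesis subP : subordinator P Phi sigma.
Variable u : R -> R.
Hypothesis potP : potential_density P sigma u.
Hypothesis u0 : forall x, 0 <= u x.
Hypothesis u_noninc : forall x y, 0 < x -> x <= y -> u y <= u x.
Local Notation v := (pos_density u).
Variable lam0 : R.
Hypothesis lam00 : 0 < lam0.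
Hypothesis Phi_gt0 : forall lam, lam0 <= lam -> 0 < Phi lam.
Let mtau := measurable_subordinator_path subP.
Let mv := measurable_pos_density u_noninc.
Let v0 := pos_density_ge0 u0.

(* The expectation of L(t)^(k+1) / (k+1)!, see the header. *)
Definition inv_moment k t : \bar R :=
  (\int[X]_z (gamma_weight k z.1 * (tau z <= t)%R%:R)%:E)%E.

Let mgw k : measurable_fun setT (fun z : measurableTypeR R * Omega => gamma_weight k z.1).
Proof.
exact: (measurableT_comp (measurable_gamma_weight (R := R) k) measurable_fst).
Qed.

Lemma laplace_integral_path k lam : lam0 <= lam ->
  laplace_integral X tau (fun z => gamma_weight k z.1) lam = ((Phi lam) ^- k.+1)%:E.
Proof.
move=> l; rewrite /laplace_integral (integral_weight_laplace subP (phi := gamma_weight k)).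
- by rewrite integral_gamma_weight// Phi_gt0.
- exact: measurable_gamma_weight.
- exact: gamma_weight_ge0.
- by move=> s s0; rewrite /gamma_weight leNgt s0 mul0r.
- exact: lt_le_trans l.
Qed.

Lemma inv_moment_ge0 k t : (0 <= inv_moment k t)%E.
Proof. by apply: integral_ge0 => z _; rewrite lee_fin mulr_ge0// gamma_weight_ge0. Qed.

Lemma inv_moment_lt0 k t : t < 0 -> inv_moment k t = 0%E.
Proof.
move=> t0; rewrite /inv_moment integral0_eq// => z _.
by rewrite leNgt (lt_le_trans t0 (subordinator_path_ge0 subP z)) mulr0.
Qed.

(** The pointwise Chernoff bound, which drives the finiteness and domination arguments below. *)
Lemma indicator_le_expR t a : (a <= t)%R%:R <= expR (lam0 * t) * expR (- lam0 * a).
Proof.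
rewrite -expRD; have [h|h] := leP a t; last by rewrite expR_ge0.
rewrite -[X in X <= _]expR0 ler_expR.
by have : 0 <= lam0 * (t - a) by [rewrite mulr_ge0 ?subr_ge0// ltW]; lra.
Qed.

Lemma inv_moment_fin k t : inv_moment k t \is a fin_num.
Proof.
rewrite ge0_fin_numE ?inv_moment_ge0//.
apply: (@le_lt_trans _ _ (\int[X]_z ((expR (lam0 * t))%:E *
    (gamma_weight k z.1 * expR (- lam0 * tau z))%:E))%E).
  apply: ge0_le_integral => //.
  - by move=> z _; rewrite lee_fin mulr_ge0// gamma_weight_ge0.
  - apply/measurable_EFinP; apply: measurable_funM => //.
    by apply: measurable_natr_bool; exact: measurable_fun_ler.
  - apply: measurable_funeM; apply/measurable_EFinP; exact: measurable_laplace_kernel.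
  - move=> z _; rewrite -EFinM lee_fin mulrCA; apply: ler_wpM2l; first exact: gamma_weight_ge0.
    exact: indicator_le_expR.
rewrite ge0_integralZl//.
- by rewrite -/(laplace_integral _ _ _ _) laplace_integral_path// -EFinM ltry.
- by apply/measurable_EFinP; exact: measurable_laplace_kernel.
- by move=> z _; rewrite lee_fin mulr_ge0 ?gamma_weight_ge0// expR_ge0.
Qed.

Lemma measurable_inv_moment k : measurable_fun setT (inv_moment k : measurableTypeR R -> \bar R).
Proof.
pose F (y : measurableTypeR R * (measurableTypeR R * Omega)) :=
  (gamma_weight k y.2.1 * (tau y.2 <= y.1)%R%:R : R).
have mF : measurable_fun setT (EFin \o F).
  apply/measurable_EFinP; apply: measurable_funM.
    exact: (measurableT_comp (mgw k) measurable_snd).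
  apply: measurable_natr_bool; apply: measurable_fun_ler => //.
  exact: (measurableT_comp mtau measurable_snd).
have F0 y : (0 <= (EFin \o F) y)%E by rewrite lee_fin mulr_ge0// gamma_weight_ge0.
exact: (@measurable_fun_fubini_tonelli_F _ _ _ _ _ (path_measure P) _ mF F0).
Qed.

(** The right side is the distribution function of the convolution of the measure with density [v]
    and the one behind [inv_moment k]. Their transforms multiply to
    [(Phi lam)^-1 * Phi lam ^- k.+1], the transform behind [inv_moment k.+1], and injectivity
    concludes. *)
Lemma inv_momentS k t :
  inv_moment k.+1 t = (\int[leb]_x ((v x)%:E * inv_moment k (t - x)%R))%E.
Proof.
(* The convolution is carried by the product space: [b] adds the positions and [h] multiplies the
   densities. As [v] vanishes at nonpositive arguments, [Num.max 0] changes no integral; it makes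
   [b] nonnegative, as injectivity requires. *)
pose b (y : measurableTypeR R * (measurableTypeR R * Omega)) : R := Num.max 0 y.1 + tau y.2.
pose h (y : measurableTypeR R * (measurableTypeR R * Omega)) : R := v y.1 * gamma_weight k y.2.1.
have mb : measurable_fun setT b.
  apply: measurable_funD; first by apply: measurable_maxr => //; exact: measurable_cst.
  exact: (measurableT_comp mtau measurable_snd).
have mh : measurable_fun setT h.
  apply: measurable_funM; first exact: (measurableT_comp mv measurable_fst).
  exact: (measurableT_comp (mgw k) measurable_snd).
have b0 y : 0 <= b y.
  by rewrite addr_ge0 ?(subordinator_path_ge0 subP)// le_max lexx.
have h0 y : 0 <= h y by rewrite mulr_ge0 ?gamma_weight_ge0.
(* Tonelli for a general test function [phi], used below with an indicator for the conclusion and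
   with an exponential for the transforms. *)
have split_h (phi : R -> R) : measurable_fun setT (phi : measurableTypeR R -> R) -> (forall x, 0 <= phi x) ->
    (\int[leb \x path_measure P]_y (h y * phi (b y))%:E
     = \int[leb]_x ((v x)%:E * \int[X]_z (gamma_weight k z.1 * phi (x + tau z)%R)%:E))%E.
  move=> mphi phi0.
  have mF : measurable_fun setT (EFin \o (fun y => h y * phi (b y))).
    by apply/measurable_EFinP; apply: measurable_funM => //; exact: measurableT_comp.
  rewrite (fubini_tonelli1 _ mF) => [|y]; last by rewrite lee_fin mulr_ge0.
  apply: eq_integral => x _; rewrite /fubini_F /h /b /=.
  have [x0|x0] := ltP 0 x; last first.
    have vx0 : v x = 0 by rewrite /pos_density ltNge x0 mul0r.
    by rewrite vx0 mul0e integral0_eq// => z _; rewrite !mul0r.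
  rewrite -ge0_integralZl//.
  - by apply: eq_integral => z _; rewrite -EFinM -mulrA.
  - apply/measurable_EFinP; apply: measurable_funM => //.
    by apply: measurableT_comp => //; exact: measurable_funD.
  - by move=> z _; rewrite lee_fin mulr_ge0// gamma_weight_ge0.
  - by rewrite lee_fin.
rewrite /inv_moment.
rewrite (laplace_integral_inj (mu := X) (nu := (leb \x path_measure P)%E)
  (a := tau) (b := b) (g := fun z => gamma_weight k.+1 z.1) (h := h) (lam0 := lam0))//.
- rewrite (split_h (fun y => (y <= t)%R%:R)).
  + apply: eq_integral => x _; congr (_ * _)%E; apply: eq_integral => z _.
    by rewrite addrC -lerBrDr.
  + by apply: measurable_natr_bool; exact: measurable_fun_ler.
  + by [].
- exact: subordinator_path_ge0 subP.
- by move=> z; exact: gamma_weight_ge0.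
- exact: ltW.
- by move=> lam l; rewrite laplace_integral_path// ltry.
- move=> lam l; rewrite laplace_integral_path// /laplace_integral.
  have lam_gt0 : 0 < lam by exact: lt_le_trans l.
  rewrite (split_h (fun y => expR (- lam * y))).
  + under eq_integral => x _.
      rewrite (_ : (\int[_]_z _)%E = (expR (- lam * x))%:E * (Phi lam ^- k.+1)%:E)%E; last first.
        rewrite -(laplace_integral_path k l) /laplace_integral -ge0_integralZl//.
        * by apply: eq_integral => z _; rewrite -EFinM mulrDr expRD mulrCA.
        * by apply/measurable_EFinP; exact: measurable_laplace_kernel.
        * by move=> z _; rewrite lee_fin mulr_ge0 ?gamma_weight_ge0// expR_ge0.
      rewrite muleA -[X in (X * _)%E]EFinM muleC.
      over.
    rewrite ge0_integralZl//.
    * rewrite (laplace_pos_density subP potP)// ?Phi_gt0//.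
      by rewrite -EFinM [in LHS]exprS invfM mulrC.
    * apply/measurable_EFinP; apply: measurable_funM => //.
      by apply: measurableT_comp => //; exact: measurable_funM.
    * by move=> x _; rewrite lee_fin mulr_ge0// expR_ge0.
    * by rewrite lee_fin invr_ge0 exprn_ge0// ltW// Phi_gt0.
  + by apply: measurableT_comp => //; exact: measurable_funM.
  + by move=> x; exact: expR_ge0.
Qed.

End InverseMoments.

(** * Identification with the convolution powers, and exponential integrals *)

Section ExpPotential.
Context (R : realType) (d : measure_display) (Omega : measurableType d).
Context (P : probability Omega R) (Phi : R -> R) (sigma : R -> Omega -> R).
Local Notation tau := (subordinator_path sigma).
Local Notation X := (leb \x P)%E.
Hypothesis subP : subordinator P Phi sigma.
Variable u : R -> R.
Hypothesis potP : potential_density P sigma u.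
Hypothesis u0 : forall x, 0 <= u x.
Hypothesis u_noninc : forall x y, 0 < x -> x <= y -> u y <= u x.
Local Notation v := (pos_density u).
Variable lam0 : R.
Hypothesis lam00 : 0 < lam0.
Hypothesis Phi_gt0 : forall lam, lam0 <= lam -> 0 < Phi lam.
Let mtau := measurable_subordinator_path subP.
Let mv := measurable_pos_density u_noninc.
Let v0 := pos_density_ge0 u0.
Let mgw k : measurable_fun setT (fun z : measurableTypeR R * Omega => gamma_weight k z.1).
Proof.
exact: (measurableT_comp (measurable_gamma_weight (R := R) k) measurable_fst).
Qed.

(** Both sides obey the same recursion. The index shifts by one because [ustar u 0] is the constant
    1, while [inv_moment] at order 0 is already [Ucum u]. *)
Lemma inv_moment_ustar k t : 0 <= t -> inv_moment P sigma k t = (ustar u k.+1 t)%:E.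
Proof.
elim: k t => [|k ih] t t0.
  (* The real integral in [ustar] is [fine] of an extended one, and [fine] sends infinity to 0;
     finiteness of the moment allows the comparison to take place under [fine]. *)
  rewrite -(fineK (inv_moment_fin subP lam00 Phi_gt0 0 t)); congr EFin.
  rewrite /= /Ucum /Rintegral; congr fine.
  transitivity (\int[X]_z ((0 <= z.1)%R%:R * (tau z <= t)%R%:R)%:E)%E.
    by apply: eq_integral => z _; rewrite /gamma_weight expr0 divr1 mulr1.
  rewrite (integral_path_potential subP potP u0 u_noninc (f := fun x => (x <= t)%R%:R))//; last first.
    by apply: measurable_natr_bool; exact: measurable_fun_ler.
  rewrite (_ : [set x | 0 <= x <= t] = `[0, t]%classic); last first.
    by apply/seteqP; split => x /=; rewrite in_itv.
  have vE x : x \in `]0, t]%classic -> v x = u x.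
    by move/set_mem => /=; rewrite in_itv /= => /andP[x0 _]; rewrite /pos_density x0 mul1r.
  (* [v] and [u] may differ at 0, so this null endpoint is removed. *)
  rewrite -integral_itv_obnd_cbnd; last first.
    apply/measurable_EFinP; apply: (eq_measurable_fun v) => //.
    exact: measurable_funTS.
  rewrite [RHS]integral_mkcond; apply: eq_integral => x _; rewrite patchE mem_setE in_itv /=.
  by rewrite /pos_density; case: (0 < x); case: (x <= t); rewrite /= ?(mul0r, mulr0, mul1r, mulr1).
rewrite -(fineK (inv_moment_fin subP lam00 Phi_gt0 k.+1 t)); congr EFin.
rewrite [RHS]/= /Rintegral; congr fine.
rewrite (inv_momentS subP potP u0 u_noninc lam00 Phi_gt0).
have mI := measurable_inv_moment subP k.
have mf : measurable_fun setT
    (fun x : measurableTypeR R => (v x)%:E * inv_moment P sigma k (t - x)%R)%E.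
  apply: emeasurable_funM; first exact/measurable_EFinP.
  by apply: measurableT_comp => //; exact: measurable_funB.
have mg : measurable_fun setT
    (fun x : measurableTypeR R => (v (t - x))%:E * inv_moment P sigma k x)%E.
  apply: emeasurable_funM => //; apply/measurable_EFinP.
  by apply: measurableT_comp => //; exact: measurable_funB.
(* The reflection moves the argument of the density to [t - x], as in the recursion for [ustar]. *)
rewrite -(integral_reflection t mf) => [|x]; last first.
  by rewrite mule_ge0 ?inv_moment_ge0// lee_fin.
rewrite (_ : [set x | 0 <= x <= t] = `[0, t]%classic); last first.
  by apply/seteqP; split => x /=; rewrite in_itv.
(* The right endpoint is left out: at [x = t] the factor [v 0] is 0, whereas [u 0] is arbitrary. *)
have gE x : x \in `[0, t[%classic ->
    ((v (t - x))%:E * inv_moment P sigma k x)%E = (u (t - x) * ustar u k.+1 x)%:E.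
  move/set_mem => /=; rewrite in_itv /= => /andP[x0 xt].
  by rewrite ih// /pos_density subr_gt0 xt mul1r EFinM.
rewrite -integral_itv_bndo_bndc; last first.
  have mm : measurable_fun (`[0, t[%classic : set (measurableTypeR R))
      (EFin \o (fun x => u (t - x) * ustar u k.+1 x)).
    by apply: (eq_measurable_fun _ _ (measurable_funTS mg)) => x xt; exact: gE.
  exact: mm.
rewrite [RHS]integral_mkcond; apply: eq_integral => x _; rewrite patchE.
rewrite (_ : t - (t - x) = x); last by ring.
case: ifPn => [xt|]; first by rewrite gE.
rewrite mem_setE in_itv /= negb_and -ltNge -leNgt => /orP[x0|tx].
  by rewrite (inv_moment_lt0 subP k x0) mule0.
by rewrite /pos_density subr_gt0 ltNge tx mul0r mul0e.
Qed.

(** When finite, this is the mean of (exp(l L(t)) - 1) / l for nonzero [l], and the mean of L(t) for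
    [l = 0]. *)
Definition exp_potential l t : \bar R :=
  (\int[X]_z ((0 <= z.1)%R%:R * (expR (l * z.1) * (tau z <= t)%R%:R))%:E)%E.

Variables (l lam : R).
Hypotheses (lam_ge : lam0 <= lam) (lam_l : `|l| < Phi lam).

(** Dominating function: the Chernoff bound at [lam] times exp(|l| s). At time s >= 0 its mean over
    [Omega] is exp(lam t) exp(-(Phi(lam) - |l|) s), integrable in s because |l| < Phi(lam). *)
Let q t (z : measurableTypeR R * Omega) : R :=
  expR (lam * t) * ((0 <= z.1)%R%:R * expR (`|l| * z.1) * expR (- lam * tau z)).

Let integrable_q t : (leb \x P)%E.-integrable setT (EFin \o q t).
Proof.
have lam_gt0 : 0 < lam by exact: lt_le_trans lam_ge.
pose phi (s : R) : R := (0 <= s)%R%:R * expR (`|l| * s).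
have mphi : measurable_fun setT (phi : measurableTypeR R -> R).
  apply: measurable_funM; first by apply: measurable_natr_bool; exact: measurable_fun_ler.
  by apply: measurableT_comp => //; exact: measurable_funM.
have phi0 s : 0 <= phi s by rewrite mulr_ge0// expR_ge0.
have mphi' : measurable_fun setT (fun z : measurableTypeR R * Omega => phi z.1).
  exact: (measurableT_comp mphi measurable_fst).
suff iq : (leb \x P)%E.-integrable setT (fun z => (phi z.1 * expR (- lam * tau z))%:E).
  have := integrableZl measurableT (expR (lam * t)) iq.
  by apply: eq_integrable.
apply/integrableP; split.
  by apply/measurable_EFinP; exact: measurable_laplace_kernel.
under eq_integral do rewrite gee0_abs ?lee_fin ?mulr_ge0 ?expR_ge0//.
rewrite (integral_weight_laplace subP mphi phi0) => [|s s0|//]; last first.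
  by rewrite /phi leNgt s0 mul0r.
under eq_integral => s _.
  rewrite (_ : phi s * _ = gamma_weight 0 s * expR (- (Phi lam - `|l|) * s)); last first.
    rewrite /phi /gamma_weight expr0 divr1 mulr1 -mulrA -expRD; congr (_ * expR _); ring.
  over.
by rewrite integral_gamma_weight ?subr_gt0// ltry.
Qed.

(** The free [y] covers both [expR (l * z.1)] and all partial sums of its series. *)
Let le_q t z (y : R) : `|y| <= expR (`|l| * z.1) ->
  `|(0 <= z.1)%R%:R * (y * (tau z <= t)%R%:R)| <= q t z.
Proof.
have lam_gt0 : 0 < lam by exact: lt_le_trans lam_ge.
move=> hy; rewrite !normrM !normr_nat /q.
rewrite (_ : _ * (_ * _ * _) = (0 <= z.1)%R%:R *
  (expR (`|l| * z.1) * (expR (lam * t) * expR (- lam * tau z)))); last by ring.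
apply: ler_wpM2l => //; apply: ler_pM => //; exact: indicator_le_expR.
Qed.

Lemma exp_potential_ge0 t : (0 <= exp_potential l t)%E.
Proof. by apply: integral_ge0 => z _; rewrite lee_fin !mulr_ge0// expR_ge0. Qed.

Let mexp t : measurable_fun setT (fun z : measurableTypeR R * Omega =>
   (0 <= z.1)%R%:R * (expR (l * z.1) * (tau z <= t)%R%:R) : R).
Proof.
apply: measurable_funM.
  by apply: measurable_natr_bool; exact: measurable_fun_ler.
apply: measurable_funM; last by apply: measurable_natr_bool; exact: measurable_fun_ler.
apply: measurableT_comp => //; apply: measurable_funM => //; exact: measurable_fst.
Qed.

Lemma exp_potential_fin t : exp_potential l t \is a fin_num.
Proof.
rewrite ge0_fin_numE ?exp_potential_ge0//.
have /integrableP[_] := integrable_q t; apply: le_lt_trans.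
apply: ge0_le_integral => //.
- exact/measurable_EFinP.
- by have /integrableP[mq _] := integrable_q t; exact: measurableT_comp.
- move=> z _ /=; rewrite lee_fin.
  have [z0|z0] := leP 0 z.1; last by rewrite mul0r.
  rewrite -[X in X * _]/(true%:R) -z0.
  apply: le_trans (ler_norm _) _; apply: le_trans (le_q _ _) (ler_norm _).
  by rewrite ger0_norm ?expR_ge0// ler_expR ler_wpM2r// ler_norm.
Qed.

(** The partial sums of the exponential series are dominated by [q], and the term of order [k]
    integrates to [l ^+ k] times [inv_moment] at order [k]. *)
Lemma cvg_exp_potential t : 0 <= t ->
  (fun n => (\sum_(k < n) l ^+ k * ustar u k.+1 t)%:E) @ \oo --> exp_potential l t.
Proof.
move=> t0.
rewrite (_ : (fun n => _) = (fun n => \int[X]_z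
  ((0 <= z.1)%R%:R * (series (exp_coeff (l * z.1)) n * (tau z <= t)%R%:R))%:E)%E).
  apply: (@cvg_integral_dominated _ _ _ _ _ _ (q t)).
  - move=> n; apply: measurable_funM.
      by apply: measurable_natr_bool; exact: measurable_fun_ler.
    apply: measurable_funM; last by apply: measurable_natr_bool; exact: measurable_fun_ler.
    rewrite /series /=; apply: measurable_sum => i; rewrite /exp_coeff /=.
    apply: measurable_funM => //; apply: measurable_funX; apply: measurable_funM => //.
  - exact: mexp.
  - move=> z; apply: cvgMl_tmp; apply: cvgMr_tmp; exact: is_cvg_series_exp_coeff.
  - move=> n z; have [z0|z0] := leP 0 z.1; last first.
      by rewrite mul0r normr0 mulr_ge0 ?expR_ge0// !mulr_ge0// expR_ge0.
    rewrite -[X in `|X * _|]/(true%:R) -z0; apply: le_q.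
    by apply: le_trans (norm_series_exp_coeff _ _) _; rewrite normrM (ger0_norm z0).
  - exact: integrable_q.
apply/funext => n; rewrite -sumEFin.
under eq_bigr => k _ do rewrite EFinM -inv_moment_ustar//.
have im k : (leb \x P)%E.-integrable setT
    (fun z => (gamma_weight k z.1 * (tau z <= t)%R%:R)%:E).
  apply/integrableP; split.
    apply/measurable_EFinP; apply: measurable_funM => //.
    by apply: measurable_natr_bool; exact: measurable_fun_ler.
  suff -> : (\int[leb \x P]_z `|(gamma_weight k z.1 * (tau z <= t)%R%:R)%:E|
      = inv_moment P sigma k t)%E.
    by rewrite -ge0_fin_numE ?inv_moment_ge0//; exact: (inv_moment_fin subP lam00 Phi_gt0).
  by apply: eq_integral => z _; rewrite gee0_abs// lee_fin mulr_ge0// gamma_weight_ge0.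
under eq_bigr => k _ do rewrite /inv_moment -integralZl//.
rewrite -integral_sum//; last by move=> k; exact: integrableZl.
apply: eq_integral => z _.
rewrite /series /= big_mkord mulr_suml mulr_sumr -sumEFin.
apply: eq_bigr => k _; rewrite -EFinM; congr EFin.
by rewrite /gamma_weight /exp_coeff /= exprMn; ring.
Qed.

End ExpPotential.

(** * The inverse subordinator, path by path *)

Section Inverse.
Context (R : realType) (d : measure_display) (Omega : measurableType d).
Context (P : probability Omega R) (Phi : R -> R) (sigma : R -> Omega -> R).
Local Notation tau := (subordinator_path sigma).
Local Notation X := (leb \x P)%E.
Hypothesis subP : subordinator P Phi sigma.
Variables (t : R) (t0 : 0 <= t).
Let mtau := measurable_subordinator_path subP.
Local Notation L := (Linv sigma t).
Let S w := [set y | 0 < y /\ t < sigma y w].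

Lemma Linv_ge0 w : 0 <= L w.
Proof.
have [[y Sy]|/set0P/negP/negPn/eqP S0] := pselect (S w !=set0).
  by apply: lb_le_inf; [exists y|move=> x [x0 _]; exact: ltW].
by rewrite /Linv -/(S w) S0 inf0.
Qed.

Lemma sigma_le_of_lt_Linv w s : 0 <= s -> s < L w -> sigma s w <= t.
Proof.
have [_ [s00 _]] := subP.
move=> s0 sL; rewrite leNgt; apply/negP => ts.
(* [S w] contains positive times only; [s = 0] is excluded because [sigma 0 w = 0 <= t]. *)
have sgt0 : 0 < s.
  by rewrite lt_neqAle s0 andbT; apply/eqP => se; move: ts; rewrite -se s00 ltNge t0.
suff : L w <= s by rewrite leNgt sL.
apply: ge_inf; last by split.
by exists 0 => x [x0 _]; exact: ltW.
Qed.

Lemma lt_sigma_of_Linv_lt w s : S w !=set0 -> L w < s -> t < sigma s w.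
Proof.
have [_ [_ [mono _]]] := subP.
move=> S0 Ls; have [y [y0 ty] ys] := inf_lt S0 Ls.
by apply: lt_le_trans ty _; apply: mono; exact: ltW.
Qed.

(** The times s >= 0 with [sigma s w <= t] form [[0, L w]] or [[0, L w[], according to whether
    [sigma (L w) w <= t], and the endpoint is null. If the path never exceeds [t], they form a
    half-line while [L w] is 0, the infimum of the empty set; hence the hypothesis on [S w]. *)
Lemma integral_path_le w (f : R -> R) : S w !=set0 ->
  measurable_fun setT (f : measurableTypeR R -> R) ->
  (\int[leb]_s ((0 <= s)%R%:R * (f s * (tau (s, w) <= t)%R%:R))%:E
   = \int[leb]_(s in `[0%R, L w]) (f s)%:E)%E.
Proof.
move=> S0 mf.
transitivity (\int[leb]_s (((0 <= s)%R && (sigma s w <= t)%R)%:R * f s)%:E)%E.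
  apply: eq_integral => s _; rewrite /subordinator_path /=; congr EFin.
  have [s0|s0] := leP 0 s; last by rewrite !mul0r.
  by rewrite mul1r mulrC.
rewrite integral_indicator_mul.
have L0 := Linv_ge0 w.
have [tL|tL] := leP (sigma (L w) w) t.
  congr (integral _ _ _); apply/seteqP; split => s /=; rewrite in_itv /=.
    move=> /andP[s0 st]; rewrite s0 /= leNgt; apply/negP => Ls.
    by have := lt_sigma_of_Linv_lt S0 Ls; rewrite ltNge st.
  move=> /andP[s0]; rewrite le_eqVlt s0 => /predU1P[->//|sL] /=.
  exact: sigma_le_of_lt_Linv.
rewrite -integral_itv_bndo_bndc; last first.
  by apply/measurable_EFinP; exact: measurable_funTS.
congr (integral _ _ _); apply/seteqP; split => s /=; rewrite in_itv /=.
  move=> /andP[s0 st]; rewrite s0 /= ltNge le_eqVlt; apply/negP => /predU1P[Ls|Ls].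
    by move: st; rewrite -Ls leNgt tL.
  by have := lt_sigma_of_Linv_lt S0 Ls; rewrite ltNge st.
by move=> /andP[s0 sL]; rewrite s0 /=; exact: sigma_le_of_lt_Linv.
Qed.

Definition exp_occupation l w : \bar R :=
  (\int[leb]_s ((0 <= s)%R%:R * (expR (l * s) * (tau (s, w) <= t)%R%:R))%:E)%E.

Let F l (z : measurableTypeR R * Omega) : R :=
  (0 <= z.1)%R%:R * (expR (l * z.1) * (tau z <= t)%R%:R).

Let mF l : measurable_fun setT (EFin \o F l).
Proof.
apply/measurable_EFinP; apply: measurable_funM.
  by apply: measurable_natr_bool; exact: measurable_fun_ler.
apply: measurable_funM; last by apply: measurable_natr_bool; exact: measurable_fun_ler.
by apply: measurableT_comp => //; exact: measurable_funM.
Qed.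

Let F0 l z : (0 <= (EFin \o F l) z)%E.
Proof. by rewrite lee_fin !mulr_ge0// expR_ge0. Qed.

Lemma measurable_exp_occupation l : measurable_fun setT (exp_occupation l).
Proof. exact: (measurable_fun_fubini_tonelli_G _ (mF l) (F0 l)). Qed.

Lemma exp_occupation_ge0 l w : (0 <= exp_occupation l w)%E.
Proof. by apply: integral_ge0 => s _; exact: (F0 l (s, w)). Qed.

Lemma integral_exp_occupation l :
  (\int[P]_w exp_occupation l w = exp_potential P sigma l t)%E.
Proof. exact/esym/(fubini_tonelli2 _ (mF l) (F0 l)). Qed.

Let measurable_expRM l : measurable_fun setT (fun s : measurableTypeR R => expR (l * s)).
Proof. by apply: measurableT_comp => //; exact: measurable_funM. Qed.

Lemma exp_occupationE l w : S w !=set0 ->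
  (l%:E * exp_occupation l w = (expR (l * L w) - 1)%:E)%E.
Proof.
move=> S0; rewrite /exp_occupation (integral_path_le S0 (measurable_expRM l)).
rewrite -integral_expRMl ?Linv_ge0// -integralZl//.
apply: continuous_compact_integrable; first exact: segment_compact.
by apply: continuous_subspaceT; exact: continuous_expRMl.
Qed.

Lemma exp_occupation0 w : S w !=set0 -> exp_occupation 0 w = (L w)%:E.
Proof.
move=> S0; rewrite /exp_occupation (integral_path_le S0 (measurable_expRM 0)).
under eq_integral do rewrite mul0r expR0.
rewrite integral_cst// mul1e [LHS]lebesgue_measure_itv /= lte_fin.
have := Linv_ge0 w; rewrite le_eqVlt => /predU1P[<-|->]; first by rewrite ltxx.
by rewrite -EFinB subr0.
Qed.

Lemma exp_occupation0_pinfty w : ~ (S w !=set0) -> exp_occupation 0 w = +oo%E.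
Proof.
move=> S0.
have path_le s : 0 <= s -> tau (s, w) <= t.
  have [_ [s00 _]] := subP.
  rewrite /subordinator_path /= le_eqVlt => /predU1P[<-|s0]; first by rewrite maxxx s00.
  rewrite (max_r (ltW s0)) leNgt; apply/negP => ts; by apply: S0; exists s.
rewrite /exp_occupation.
transitivity (\int[@lebesgue_measure R]_s ((0 <= s)%R%:R * 1)%:E)%E.
  apply: eq_integral => s _; have [s0|s0] := leP 0 s; last by rewrite !mul0r.
  by rewrite path_le// mul0r expR0 !mulr1.
rewrite integral_indicator_mul (_ : [set _ | _] = `[0, +oo[%classic); last first.
  by apply/seteqP; split => x /=; rewrite in_itv /= andbT.
by rewrite integral_cst// mul1e [LHS]lebesgue_measure_itv /= ltry.
Qed.

(** If the path never exceeds [t], its occupation time is infinite and [fine] sends it to 0, which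
    is also the infimum of the empty set. The identity thus holds at every [w] and yields
    measurability of [L]. *)
Lemma LinvE w : L w = fine (exp_occupation 0 w).
Proof.
have [S0|S0] := pselect (S w !=set0); first by rewrite exp_occupation0.
rewrite exp_occupation0_pinfty//= /Linv -/(S w).
by move/set0P/negP/negPn/eqP : S0 => ->; exact: inf0.
Qed.

Lemma measurable_Linv : measurable_fun setT (L : Omega -> R).
Proof.
rewrite (_ : L = fine \o exp_occupation 0); last by apply/funext => w; exact: LinvE.
by apply: measurableT_comp => //; exact: measurable_exp_occupation.
Qed.

Lemma emlfE l : exp_potential P sigma 0 t \is a fin_num ->
  exp_potential P sigma l t \is a fin_num ->
  emlf P sigma t l = (1 + l%:E * exp_potential P sigma l t)%E.
Proof.
move=> fin0 finl.
have iocc k : exp_potential P sigma k t \is a fin_num ->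
    P.-integrable setT (exp_occupation k).
  move=> fk; apply/integrableP; split; first exact: measurable_exp_occupation.
  under eq_integral do rewrite gee0_abs ?exp_occupation_ge0//.
  by rewrite integral_exp_occupation -ge0_fin_numE// exp_potential_ge0.
rewrite /emlf (ae_eq_integral (fun w => 1 + l%:E * exp_occupation l w)%E)//.
- rewrite integralD//.
  + rewrite integral_cst// mul1e [X in (X + _)%E]probability_setT; congr (_ + _)%E.
    by rewrite integralZl ?integral_exp_occupation//; exact: iocc.
  + exact: finite_measure_integrable_cst.
  + by apply: integrableZl => //; exact: iocc.
- apply/measurable_EFinP; apply: measurableT_comp => //; apply: measurable_funM => //.
  exact: measurable_Linv.
- apply: emeasurable_funD => //; apply: measurable_funeM; exact: measurable_exp_occupation.
(* A finite mean makes [exp_occupation 0] finite almost surely, so almost every path eventually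
   exceeds [t] and [exp_occupationE] applies. *)
- have := integrable_ae measurableT (iocc 0 fin0).
  apply: filterS => w /(_ I) fw _.
  have [S0|S0] := pselect (S w !=set0); last by rewrite exp_occupation0_pinfty in fw.
  by rewrite exp_occupationE// -EFinD; congr EFin; ring.
Qed.

End Inverse.

(** * The exponential moment of the inverse as a power series *)

Theorem mainTheorem11 (R : realType) (d : measure_display) (Omega : measurableType d)
  (P : probability Omega R) (Phi : R -> R) (sigma : R -> Omega -> R) (u : R -> R)
  (t0 C beta : R) :
  special_bernstein Phi ->
  LK_zero_triple_infinite Phi ->
  subordinator P Phi sigma ->
  potential_density P sigma u ->
  (forall x, 0 <= u x) ->
  (forall x y, 0 < x -> x <= y -> u y <= u x) ->
  0 < t0 -> 0 < C -> 0 < beta < 1 ->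
  (forall x, 0 < x < t0 -> u x <= C * powR x (beta - 1)) ->
  forall (l t : R), 0 <= t ->
    exists e : R,
      emlf P sigma t l = e%:E /\
      (fun n : nat => \sum_(0 <= k < n) l ^+ k * ustar u k t) @ \oo --> e.
Proof.
move=> _ LK subP potP u0 u_noninc _ _ _ _ l t t_ge0.
(* From [lam0] on [Phi] is positive, from [lam1] on it exceeds |l|; [lam] meets both
   requirements. *)
have [lam0 lam0_gt0 Phi_gt0] := LK_unbounded LK 0.
have [lam1 _ Phi_gtl] := LK_unbounded LK `|l|.
pose lam := Num.max lam0 lam1.
have lam_ge : lam0 <= lam by rewrite le_max lexx.
have lam_l : `|l| < Phi lam by apply: Phi_gtl; rewrite le_max lexx orbT.
have fin0 : exp_potential P sigma 0 t \is a fin_num.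
  by apply: (exp_potential_fin subP lam0_gt0 (lexx lam0)); rewrite normr0 Phi_gt0.
have finl := exp_potential_fin subP lam0_gt0 lam_ge lam_l t.
exists (1 + l * fine (exp_potential P sigma l t)); split.
  by rewrite (emlfE subP t_ge0)// EFinD EFinM fineK.
(* The term of order 0 is the leading 1; the remaining terms share a factor [l], which aligns
   [l ^+ k] with [ustar u k.+1]. *)
rewrite -cvg_shiftS.
rewrite (_ : (fun n => _) = (fun n => 1 + l * \sum_(k < n) l ^+ k * ustar u k.+1 t)).
  apply: cvgD; first exact: cvg_cst.
  apply: cvgMl_tmp.
  have := cvg_exp_potential subP potP u0 u_noninc lam0_gt0 Phi_gt0 lam_ge lam_l t_ge0.
  by rewrite -(fineK finl) => /fine_cvg.
apply/funext => n; rewrite big_mkord big_ord_recl /= expr0 mulr1; congr (_ + _).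
by rewrite mulr_sumr; apply: eq_bigr => k _; rewrite exprS -mulrA.
Qed.
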